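(* Let $k$ be a commutative ring, let $A\,|\,B$ be an extension of unital associative $k$-algebras, and let $R = C_A(B)$ be its centralizer. If $A\,|\,B$ is left depth two, then every two-sided ideal $I$ of $A$ satisfies $$A(I\cap R)\subseteq (I\cap R)A.$$ If $A\,|\,B$ is right depth two, then every two-sided ideal $I$ of $A$ satisfies $$(I\cap R)A\subseteq A(I\cap R).$$
   Context: An algebra extension $A\,|\,B$ is a unital algebra homomorphism $B\to A$ (for example the inclusion of a subalgebra $B\subseteq A$ with $1_B=1_A$). $A$ is viewed as a $B$-bimodule via this homomorphism, and the centralizer is $C_A(B)=\{r\in A : rb=br \text{ for all } b\in B\}$, where $b$ acts through its image in $A$. The extension is left depth two (left D2) if for some positive integer $n$ the natural $B$-$A$-bimodule $A\otimes_B A$ is isomorphic to a direct summand of $A^n$ as $B$-$A$-bimodules. It is right depth two (right D2) if for some positive integer $n$ the natural $A$-$B$-bimodule $A\otimes_B A$ is isomorphic to a direct summand of $A^n$ as $A$-$B$-bimodules. For subsets $X,Y\subseteq A$, $XY$ denotes the additive subgroup of $A$ generated by all products $xy$ with $x\in X$, $y\in Y$. *)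

(* Defs.v *)
From HB Require Import structures.
From mathcomp Require Import all_boot all_algebra ring_quotient.
From mathcomp Require Import boolp classical_sets.
From mathcomp.multinomials Require Import freeg.

Set Implicit Arguments.
Unset Strict Implicit.
Unset Printing Implicit Defensive.

Import GRing.Theory.
Local Open Scope classical_set_scope.
Local Open Scope quotient_scope.
Local Open Scope ring_scope.

(* The library's algType excludes the zero ring, so an associative unital
   algebra over k is taken to be a possibly trivial ring together with a ring
   morphism from k to its center.  See kalgebra_of_algType. *)
Record kalgebra (k : comPzRingType) := KAlgebra {
  kalg_ring :> pzRingType;
  kalg_map : {rmorphism k -> kalg_ring};
  kalg_mapC : forall (c : k) (a : kalg_ring), kalg_map c * a = a * kalg_map c
}.

Lemma in_algC (k : comPzRingType) (A : algType k) (c : k) (a : A) :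
  in_alg A c * a = a * in_alg A c.
Proof. by rewrite mulr_algl mulr_algr. Qed.

Definition kalgebra_of_algType (k : comPzRingType) (A : algType k) :
  kalgebra k := @KAlgebra k A (in_alg A) (@in_algC k A).

Definition is_kalg_morphism (k : comPzRingType) (B A : kalgebra k)
  (phi : {rmorphism B -> A}) : Prop :=
  forall c : k, phi (kalg_map B c) = kalg_map A c.

Definition centralizer (A B : pzRingType) (phi : {rmorphism B -> A}) : set A :=
  [set r | forall b : B, r * phi b = phi b * r].

Definition subgroup (V : zmodType) (H : set V) : Prop :=
  H 0 /\ (forall x y, H x -> H y -> H (x - y)).

Definition two_sided_ideal (A : pzRingType) (I : set A) : Prop :=
  subgroup I /\ (forall a x, I x -> I (a * x) /\ I (x * a)).

Definition subgroup_gen (V : zmodType) (S : set V) : set V :=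
  smallest (@subgroup V) S.

Definition mul_sets (A : pzRingType) (X Y : set A) : set A :=
  subgroup_gen [set z | exists x y, [/\ X x, Y y & z = x * y]].

(* Both actions are fields of a record because a carrier can bear only one
   canonical lmodType structure over a given ring, and here the two acting
   rings may coincide. *)
Record bimodule (L R : pzRingType) := Bimodule {
  bim_sort :> zmodType;
  lact : L -> bim_sort -> bim_sort;
  ract : bim_sort -> R -> bim_sort;
  lact1 : forall m, lact 1 m = m;
  lactM : forall l l' m, lact (l * l') m = lact l (lact l' m);
  lactDl : forall l l' m, lact (l + l') m = lact l m + lact l' m;
  lactDr : forall l m m', lact l (m + m') = lact l m + lact l m';
  ract1 : forall m, ract m 1 = m;
  ractM : forall m r r', ract m (r * r') = ract (ract m r) r';
  ractDl : forall m m' r, ract (m + m') r = ract m r + ract m' r;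
  ractDr : forall m r r', ract m (r + r') = ract m r + ract m r';
  lractA : forall l m r, ract (lact l m) r = lact l (ract m r)
}.

Definition bimodule_iso (L R : pzRingType) (M N : bimodule L R) : Prop :=
  exists f : {additive M -> N},
    [/\ bijective f, forall l m, f (lact l m) = lact l (f m)
      & forall m r, f (ract m r) = ract (f m) r].

Section Constructions.
Variables (L R : pzRingType).

(* A as an L-R-bimodule by restriction of scalars along f and g. *)
Definition regular_bimodule (A : pzRingType) (f : {rmorphism L -> A})
  (g : {rmorphism R -> A}) : bimodule L R.
Proof.
refine (@Bimodule L R A (fun l a => f l * a) (fun a r => a * g r)
  _ _ _ _ _ _ _ _ _) => *.
- by rewrite rmorph1 mul1r.
- by rewrite rmorphM mulrA.
- by rewrite rmorphD mulrDl.
- by rewrite mulrDr.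
- by rewrite rmorph1 mulr1.
- by rewrite rmorphM mulrA.
- by rewrite mulrDl.
- by rewrite rmorphD mulrDr.
- by rewrite mulrA.
Defined.

Definition bimodule_sum (M N : bimodule L R) : bimodule L R.
Proof.
refine (@Bimodule L R (M * N)%type
  (fun l p => (lact l p.1, lact l p.2)) (fun p r => (ract p.1 r, ract p.2 r))
  _ _ _ _ _ _ _ _ _).
- by case=> m n; rewrite /= !lact1.
- by move=> l l' p; rewrite !lactM.
- by move=> l l' p; rewrite !lactDl.
- by move=> l p p'; rewrite !lactDr.
- by case=> m n; rewrite /= !ract1.
- by move=> p r r'; rewrite !ractM.
- by move=> p p' r; rewrite !ractDl.
- by move=> p r r'; rewrite !ractDr.
- by move=> l p r; rewrite /= !lractA.
Defined.

Definition bimodule_pow (M : bimodule L R) (n : nat) : bimodule L R.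
Proof.
refine (@Bimodule L R {ffun 'I_n -> M}
  (fun l u => [ffun i => lact l (u i)]) (fun u r => [ffun i => ract (u i) r])
  _ _ _ _ _ _ _ _ _) => *; apply/ffunP => i; rewrite !ffunE.
- by rewrite lact1.
- by rewrite lactM.
- by rewrite lactDl.
- by rewrite lactDr.
- by rewrite ract1.
- by rewrite ractM.
- by rewrite ractDl.
- by rewrite ractDr.
- by rewrite lractA.
Defined.

End Constructions.

Definition iso_direct_summand (L R : pzRingType) (M N : bimodule L R) : Prop :=
  exists Q : bimodule L R, bimodule_iso (bimodule_sum M Q) N.

(* M (x)_S N is the quotient of the free abelian group on M * N by the subgroup
   generated by the balancing relators; tensor_liftE and tensor_lift_unique are
   its universal property. *)
Section Tensor.
Variables (L S R : pzRingType) (M : bimodule L S) (N : bimodule S R).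

Local Notation F := {freeg (M * N)%type / int}.

Definition fgen (m : M) (n : N) : F := << (1 : int) *g (m, n) >>.

Definition tensor_relator : set F := [set x |
  [\/ exists m m' n, x = fgen (m + m') n - fgen m n - fgen m' n,
      exists m n n', x = fgen m (n + n') - fgen m n - fgen m n'
    | exists m s n, x = fgen (ract m s) n - fgen m (lact s n)]].

Definition tensor_ker : {pred F} :=
  fun x => `[< subgroup_gen tensor_relator x >].

Lemma tensor_kerP x :
  reflect (subgroup_gen tensor_relator x) (x \in tensor_ker).
Proof. exact: asboolP. Qed.

Lemma tensor_ker_zmod_closed : zmod_closed tensor_ker.
Proof.
split=> [|x y /tensor_kerP Kx /tensor_kerP Ky]; apply/tensor_kerP.
  by move=> H [[H0 _] _]; exact: H0.
move=> H /[dup] HH [[_ HB] _]; apply: HB; [exact: Kx|exact: Ky].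
Qed.

HB.instance Definition _ :=
  GRing.isZmodClosed.Build F tensor_ker tensor_ker_zmod_closed.

Local Notation Q := (Quotient.quot tensor_ker).

Definition tensor := Q.
HB.instance Definition _ := GRing.Zmodule.on tensor.

Definition tens (m : M) (n : N) : tensor := \pi_Q (fgen m n).

Definition balanced (V : zmodType) (h : M -> N -> V) : Prop :=
  [/\ forall m m' n, h (m + m') n = h m n + h m' n,
      forall m n n', h m (n + n') = h m n + h m n'
    & forall m s n, h (ract m s) n = h m (lact s n)].

Lemma tens_eq0 x : tensor_relator x -> \pi_Q x = 0.
Proof.
move=> Rx; apply/eqP; rewrite -(@pi_zeror _ _ 0 -%R +%R Q).
rewrite -Quotient.idealrBE subr0.
by apply/tensor_kerP; apply: sub_gen_smallest.
Qed.

Lemma pi_tensorB (x y : F) : \pi_Q (x - y) = \pi_Q x - \pi_Q y :> tensor.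
Proof. exact: raddfB. Qed.

Lemma tens_balanced : balanced tens.
Proof.
split=> [m m' n|m n n'|m s n]; apply/eqP; rewrite -subr_eq0 ?opprD ?addrA;
  rewrite /tens -!pi_tensorB; apply/eqP/tens_eq0.
- by apply: Or31; exists m, m', n.
- by apply: Or32; exists m, n, n'.
- by apply: Or33; exists m, s, n.
Qed.

Section Lift.
Variables (V : zmodType) (h : M -> N -> V).

Definition free_lift (x : F) : V := fglift (fun p => h p.1 p.2 : zmodule V) x.

Lemma free_liftB x y : free_lift (x - y) = free_lift x - free_lift y.
Proof. exact: (@lift_is_additive int _ (zmodule V)). Qed.

Lemma free_lift_gen m n : free_lift (fgen m n) = h m n.
Proof. by rewrite /free_lift liftU scale1r. Qed.

Definition tensor_lift (x : tensor) : V :=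
  free_lift (repr (x : Q)).

Hypothesis h_balanced : balanced h.

Lemma tensor_lift_pi (x : F) :
  tensor_lift (\pi_Q x) = free_lift x.
Proof.
have: repr (\pi_Q x) - x \in tensor_ker.
  by rewrite Quotient.idealrBE reprK.
move=> /tensor_kerP Kx; apply/eqP.
rewrite -subr_eq0 -free_liftB; apply/eqP.
have [hl hr hs] := h_balanced.
apply: (Kx [set y | free_lift y = 0]); split.
  split=> /= [|u v u0 v0]; first by rewrite -(subrr 0) free_liftB subrr.
  by rewrite free_liftB u0 v0 subr0.
move=> y /= [[m [m' [n ->]]]|[m [n [n' ->]]]|[m [s [n ->]]]];
  rewrite !free_liftB !free_lift_gen.
- by rewrite hl addrAC addrK subrr.
- by rewrite hr addrAC addrK subrr.
- by rewrite hs subrr.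
Qed.

Lemma tensor_liftE m n : tensor_lift (tens m n) = h m n.
Proof. by rewrite tensor_lift_pi free_lift_gen. Qed.

Lemma tensor_liftB x y : tensor_lift (x - y) = tensor_lift x - tensor_lift y.
Proof.
rewrite -[x](reprK (x : Q)) -[y](reprK (y : Q)).
by rewrite -pi_tensorB !tensor_lift_pi free_liftB.
Qed.

Lemma tensor_liftD x y : tensor_lift (x + y) = tensor_lift x + tensor_lift y.
Proof.
have L0 : tensor_lift 0 = 0 by rewrite -(subrr (0 : tensor)) tensor_liftB subrr.
by rewrite -{1}[y]opprK -(sub0r y) !tensor_liftB L0 sub0r opprK.
Qed.

End Lift.

Lemma tensor_ind (P : tensor -> Prop) :
  (forall m n, P (tens m n)) -> (forall x y, P x -> P y -> P (x - y)) ->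
  forall x, P x.
Proof.
move=> Pt PB x; rewrite -[x](reprK (x : Q)).
pose P' (y : F) := P (\pi_Q y : tensor); rewrite -/(P' _).
have PB' y z : P' y -> P' z -> P' (y - z).
  by rewrite /P' pi_tensorB; apply: PB.
have P0 : P' 0 by rewrite -(subrr (fgen 0 0)); apply: PB'; apply: Pt.
have PN y : P' y -> P' (- y) by rewrite -sub0r; apply: PB'.
have PD y z : P' y -> P' z -> P' (y + z).
  by move=> Py Pz; rewrite -[z]opprK; apply: PB' => //; apply: PN.
rewrite -[repr _]freeg_sumE; elim/big_ind: _ => // -[m n] _.
have PM i : P' (fgen m n *+ i).
  elim: i => [|i Pi]; first by rewrite mulr0n.
  by rewrite mulrSr; apply: PD => //; apply: Pt.
move: (coeff _ _) => z; rewrite -[z]intz -freegU_mulz.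
by case: z => i; rewrite ?NegzE ?mulrNz; [|apply: PN]; apply: PM.
Qed.

Lemma tensor_lift_unique (V : zmodType) (f g : tensor -> V) :
  (forall x y, f (x - y) = f x - f y) -> (forall x y, g (x - y) = g x - g y) ->
  (forall m n, f (tens m n) = g (tens m n)) -> forall x, f x = g x.
Proof.
move=> fB gB fg; apply: tensor_ind => // x y fgx fgy.
by rewrite fB gB fgx fgy.
Qed.

Definition tensor_lact (l : L) : tensor -> tensor :=
  tensor_lift (fun m n => tens (lact l m) n).

Definition tensor_ract (x : tensor) (r : R) : tensor :=
  tensor_lift (fun m n => tens m (ract n r)) x.

Lemma lact_balanced l : balanced (fun m n => tens (lact l m) n).
Proof.
have [tl tr ts] := tens_balanced.
by split=> *; rewrite ?lactDr ?tl ?tr // -ts lractA.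
Qed.

Lemma ract_balanced r : balanced (fun m n => tens m (ract n r)).
Proof.
have [tl tr ts] := tens_balanced.
by split=> *; rewrite ?ractDl ?tl ?tr // lractA ts.
Qed.

Lemma tensor_lactE l m n : tensor_lact l (tens m n) = tens (lact l m) n.
Proof. exact: (tensor_liftE (lact_balanced l)). Qed.

Lemma tensor_ractE r m n : tensor_ract (tens m n) r = tens m (ract n r).
Proof. exact: (tensor_liftE (ract_balanced r)). Qed.

Let tensE := (fun l => tensor_liftE (lact_balanced l),
  fun r => tensor_liftE (ract_balanced r)).
Let tensB := (fun l => tensor_liftB (lact_balanced l),
  fun r => tensor_liftB (ract_balanced r)).
Let tensD := (fun l => tensor_liftD (lact_balanced l),
  fun r => tensor_liftD (ract_balanced r)).

Definition tensor_bimodule : bimodule L R.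
Proof.
refine (@Bimodule L R tensor tensor_lact tensor_ract _ _ _ _ _ _ _ _ _);
  rewrite /tensor_lact /tensor_ract.
- by apply: tensor_lift_unique => *; rewrite ?tensB ?tensE ?lact1.
- move=> l l'.
  by apply: tensor_lift_unique => *; rewrite ?tensB ?tensE ?lactM.
- move=> l l'; apply: tensor_lift_unique => *.
  + by rewrite tensB.
  + by rewrite !tensB opprD addrACA.
  + by rewrite !tensE lactDl; case: tens_balanced.
- by move=> *; rewrite tensD.
- by apply: tensor_lift_unique => *; rewrite ?tensB ?tensE ?ract1.
- move=> x r r'; move: x.
  by apply: tensor_lift_unique => *; rewrite ?tensB ?tensE ?ractM.
- by move=> *; rewrite tensD.
- move=> x r r'; move: x; apply: tensor_lift_unique => *.
  + by rewrite tensB.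
  + by rewrite !tensB opprD addrACA.
  + by rewrite !tensE ractDr; case: tens_balanced.
- move=> l x r; move: x.
  by apply: tensor_lift_unique => *; rewrite ?tensB ?tensE.
Defined.

End Tensor.

Section DepthTwo.
Variables (A B : pzRingType) (phi : {rmorphism B -> A}).

Definition left_depth_two : Prop :=
  exists n : nat, (0 < n)%N /\
    iso_direct_summand
      (tensor_bimodule (regular_bimodule phi phi) (regular_bimodule phi (@idfun A)))
      (bimodule_pow (regular_bimodule phi (@idfun A)) n).

Definition right_depth_two : Prop :=
  exists n : nat, (0 < n)%N /\
    iso_direct_summand
      (tensor_bimodule (regular_bimodule (@idfun A) phi) (regular_bimodule phi phi))
      (bimodule_pow (regular_bimodule (@idfun A) phi) n).

End DepthTwo.

(* Main.v *)
Require Import Defs.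
From mathcomp Require Import all_boot all_algebra.
From mathcomp Require Import boolp classical_sets.

(** For [r] in the centralizer of [B] the map [a (x) c |-> a * r * c] is
    balanced over [B], hence defines an additive map [h] on [A (x)_B A]
    ([sandwich]) that is compatible with the actions on both outer sides and
    takes its values in every ideal containing [r].  Consequently [h] sends
    every tensor [t] with [b t = t b] for all [b] in [B] into
    [I `&` centralizer phi] as soon as [r] lies there.

    Depth two supplies many such tensors.  Being a direct summand of [A^n] means
    that the identity of [A (x)_B A] is a finite sum of composites
    [g_i \o f_i] through [A] ([summand_factor]).  The tensor [t_i = g_i 1] is
    [B]-central, because acting by [b] on either side of [1] gives [phi b].  In
    the left case [g_i] is right [A]-linear, so
    [x (x) 1 = \sum_i t_i . f_i (x (x) 1)], and applying [h] yields
    [x * r = \sum_i h t_i * f_i (x (x) 1)], which lies in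
    [(I `&` centralizer phi) A].  The right case applies [h] to [1 (x) x] and
    uses left linearity instead. *)

Set Implicit Arguments.
Unset Strict Implicit.
Unset Printing Implicit Defensive.

Import GRing.Theory.
Local Open Scope classical_set_scope.
Local Open Scope ring_scope.

(** * Additive subgroups and their products *)

Lemma subgroup_sum (V : zmodType) (H : set V) (J : finType) (F : J -> V) :
  subgroup H -> (forall j, H (F j)) -> H (\sum_j F j).
Proof.
move=> [H0 HB] HF; elim/big_ind: _ => // x y Hx Hy.
by rewrite -[y]opprK -(sub0r y); apply: (HB) => //; apply: HB.
Qed.

Lemma subgroup_gen_subgroup (V : zmodType) (S : set V) :
  subgroup (subgroup_gen S).
Proof.
split=> [H [[H0 _] _]|x y Sx Sy H HS]; first exact: H0.
by have [[_ HB] _] := HS; apply: HB; [apply: Sx|apply: Sy].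
Qed.

Lemma mul_sets_mul (A : pzRingType) (X Y : set A) x y :
  X x -> Y y -> mul_sets X Y (x * y).
Proof. by move=> Xx Yy; apply: sub_gen_smallest; exists x, y. Qed.

Lemma mul_sets_sub (A : pzRingType) (X Y H : set A) :
  subgroup H -> (forall x y, X x -> Y y -> H (x * y)) -> mul_sets X Y `<=` H.
Proof.
by move=> Hsub HXY; apply: smallest_sub => // _ [x [y [Xx Yy ->]]]; apply: HXY.
Qed.

(** * Bimodule maps and direct summands of powers *)

Section BimoduleHom.
Variables (L R : pzRingType).
Implicit Types M N P Q : bimodule L R.

Definition bimodule_hom M N (f : M -> N) : Prop :=
  [/\ forall x y, f (x - y) = f x - f y,
      forall l x, f (lact l x) = lact l (f x)
    & forall x r, f (ract x r) = ract (f x) r].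

Lemma bimodule_hom_comp M N P (g : N -> P) (f : M -> N) :
  bimodule_hom g -> bimodule_hom f -> bimodule_hom (g \o f).
Proof.
by move=> [gB gl gr] [fB fl fr]; split=> *; rewrite /= ?fB ?fl ?fr ?gB ?gl ?gr.
Qed.

Lemma bimodule_hom_sum M N (f : M -> N) (J : finType) (F : J -> M) :
  bimodule_hom f -> f (\sum_j F j) = \sum_j f (F j).
Proof.
move=> [fB _ _]; have f0 : f 0 = 0 by rewrite -(subrr 0) fB subrr.
apply: (big_morph f) => // x y.
by rewrite -{1}[y]opprK -(sub0r y) !fB f0 sub0r opprK.
Qed.

Lemma bimodule_hom_can M N (f : M -> N) (g : N -> M) :
  cancel f g -> cancel g f -> bimodule_hom f -> bimodule_hom g.
Proof.
move=> fK gK [fB fl fr]; split=> *; apply: (can_inj fK).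
- by rewrite fB !gK.
- by rewrite fl !gK.
- by rewrite fr !gK.
Qed.

Lemma lactr0 M l : lact l 0 = 0 :> M.
Proof. by apply: (addrI (lact l 0)); rewrite -lactDr !addr0. Qed.

Lemma ract0r M r : ract 0 r = 0 :> M.
Proof. by apply: (addrI (ract 0 r)); rewrite -ractDl !addr0. Qed.

Lemma lactB M l (x y : M) : lact l (x - y) = lact l x - lact l y.
Proof. by apply: (addIr (lact l y)); rewrite -lactDr !subrK. Qed.

Lemma ractB M (x y : M) r : ract (x - y) r = ract x r - ract y r.
Proof. by apply: (addIr (ract y r)); rewrite -ractDl !subrK. Qed.

Lemma bimodule_hom_inl M Q :
  @bimodule_hom M (bimodule_sum M Q) (fun x => (x, 0)).
Proof.
split=> [x y|l x|x r].
- by congr pair; rewrite /= ?subr0.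
- by rewrite /= lactr0.
- by rewrite /= ract0r.
Qed.

Lemma bimodule_hom_fst M Q : @bimodule_hom (bimodule_sum M Q) M fst.
Proof. by split. Qed.

Lemma bimodule_hom_coord N n (i : 'I_n) :
  @bimodule_hom (bimodule_pow N n) N (fun u => u i).
Proof. by split=> *; rewrite !ffunE. Qed.

Definition pow_single N n (i : 'I_n) (y : N) : bimodule_pow N n :=
  [ffun j => if j == i then y else 0].

Lemma bimodule_hom_single N n (i : 'I_n) : bimodule_hom (@pow_single N n i).
Proof.
split=> *; apply/ffunP=> j; rewrite !ffunE; case: eqP => //.
- by rewrite subr0.
- by rewrite lactr0.
- by rewrite ract0r.
Qed.

Lemma sum_pow_single N n (u : bimodule_pow N n) :
  \sum_i pow_single i (u i) = u.
Proof.
apply/ffunP=> j; rewrite sum_ffunE (bigD1 j) //= ffunE eqxx big1 ?addr0 //.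
by move=> i ne_ij; rewrite ffunE eq_sym (negPf ne_ij).
Qed.

(** This is the dual basis form of being a summand of a power: composing the
    isomorphism with the inclusions and projections on both sides splits the
    identity of [M] into [n] maps that factor through [N]. *)
Lemma summand_factor M N n : iso_direct_summand M (bimodule_pow N n) ->
  exists (f : 'I_n -> M -> N) (g : 'I_n -> N -> M),
    [/\ forall i, bimodule_hom (f i), forall i, bimodule_hom (g i)
      & forall x, x = \sum_i g i (f i x)].
Proof.
move=> [Q [phi [[psi phiK psiK] phil phir]]].
have phi_hom : bimodule_hom phi by split=> // x y; exact: raddfB.
have psi_hom := bimodule_hom_can phiK psiK phi_hom.
pose inl (x : M) : bimodule_sum M Q := (x, 0).
pose pr (u : bimodule_pow N n) : M := (psi u).1.
have pr_hom : bimodule_hom pr.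
  exact: (bimodule_hom_comp (bimodule_hom_fst M Q) psi_hom).
exists (fun i x => phi (inl x) i), (fun i y => pr (pow_single i y)).
split=> [i|i|x].
- have inl_hom := bimodule_hom_comp phi_hom (bimodule_hom_inl M Q).
  exact: (bimodule_hom_comp (bimodule_hom_coord N i) inl_hom).
- exact: (bimodule_hom_comp pr_hom (bimodule_hom_single N i)).
- rewrite -(bimodule_hom_sum _ pr_hom) sum_pow_single.
  by rewrite /pr phiK.
Qed.

End BimoduleHom.

(** * Multiplying a tensor through a centralizing element *)

Section Sandwich.
Variables (A B L R : pzRingType) (phi : {rmorphism B -> A}).
Variables (f : {rmorphism L -> A}) (g : {rmorphism R -> A}).

(* The outer rings [L] and [R] are kept arbitrary so that the left and right
   depth two conditions are both instances. *)
Local Notation AA :=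
  (tensor_bimodule (regular_bimodule f phi) (regular_bimodule phi g)).
Local Notation fAg := (regular_bimodule f g).

Variable r : A.
Hypothesis r_central : centralizer phi r.

Definition sandwich : AA -> fAg :=
  @tensor_lift L B R (regular_bimodule f phi) (regular_bimodule phi g) A
    (fun a c => a * r * c).

(** Moving [phi b] across [r] is exactly what the centralizer allows. *)
Lemma sandwich_balanced :
  @balanced L B R (regular_bimodule f phi) (regular_bimodule phi g) A
    (fun a c => a * r * c).
Proof.
split=> [a a' c|a c c'|a b c] /=.
- by rewrite !mulrDl.
- by rewrite mulrDr.
- by rewrite -(mulrA a) -r_central !mulrA.
Qed.

Lemma sandwichE (a c : A) :
  sandwich (@tens L B R (regular_bimodule f phi) (regular_bimodule phi g) a c)
    = a * r * c.
Proof. exact: tensor_liftE sandwich_balanced a c. Qed.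

Lemma sandwich_hom : bimodule_hom sandwich.
Proof.
have sB : forall x y, sandwich (x - y) = sandwich x - sandwich y.
  exact: tensor_liftB sandwich_balanced.
split=> // [l|x s]; last move: x.
- apply: tensor_lift_unique => [x y|x y|a c].
  + by rewrite [X in sandwich X]lactB sB.
  + by rewrite sB /= mulrBr.
  + by rewrite /= tensor_lactE !sandwichE /= !mulrA.
- apply: tensor_lift_unique => [x y|x y|a c].
  + by rewrite [X in sandwich X]ractB sB.
  + by rewrite sB /= mulrBl.
  + by rewrite /= tensor_ractE !sandwichE /= !mulrA.
Qed.

Lemma sandwich_ideal (I : set A) :
  two_sided_ideal I -> I r -> forall x, I (sandwich x).
Proof.
move=> [[_ IB] Imul] Ir; apply: tensor_ind => [a c|x y Ix Iy].
  by rewrite sandwichE; apply: (Imul _ _ _).2; apply: (Imul _ _ _).1.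
by have [sB _ _] := sandwich_hom; rewrite sB; apply: IB.
Qed.

(** The composite of [u] with [sandwich] is a bimodule endomorphism of [A], so
    its value at [1] commutes with every element of [A] that acts from both
    sides. *)
Lemma sandwich_hom1 (I : set A) (u : fAg -> AA) :
    two_sided_ideal I -> I r -> bimodule_hom u ->
    (forall b, exists l s, f l = phi b /\ g s = phi b) ->
  (I `&` centralizer phi) (sandwich (u (1 : A))).
Proof.
move=> idI Ir hom_u Bacts; split; first exact: sandwich_ideal.
move=> b; have [l [s [fl gs]]] := Bacts b.
have [_ hl hr] := bimodule_hom_comp sandwich_hom hom_u.
have := hl l (1 : A); rewrite /= fl mulr1 => <-.
by have := hr (1 : A) s; rewrite /= gs mul1r => <-.
Qed.

End Sandwich.

(** * Depth two *)

Lemma left_depth_two_commutation (A B : pzRingType) (phi : {rmorphism B -> A})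
    (I : set A) :
  left_depth_two phi -> two_sided_ideal I ->
  mul_sets setT (I `&` centralizer phi) `<=`
  mul_sets (I `&` centralizer phi) setT.
Proof.
move=> [n [_ /summand_factor[f [g [_ hom_g fgK]]]]] idI.
have sub := subgroup_gen_subgroup.
apply: mul_sets_sub => [|x r _ [Ir Cr]]; first exact: sub.
have hom_s := sandwich_hom phi idfun Cr.
rewrite -[x * r]mulr1 -(sandwichE phi idfun Cr) [tens _ _ in X in _ X]fgK.
rewrite (bimodule_hom_sum _ hom_s); apply: subgroup_sum => [|i]; first exact: sub.
(* Right linearity pulls [f_i (x (x) 1)], read as [1 * f_i (x (x) 1)], out. *)
move: (f i _) => y; have [_ _ hr] := bimodule_hom_comp hom_s (hom_g i).
have := hr (1 : A) y; rewrite /= mul1r => ->.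
apply: mul_sets_mul => //; apply: sandwich_hom1 => // b.
by exists b, (phi b).
Qed.

Lemma right_depth_two_commutation (A B : pzRingType) (phi : {rmorphism B -> A})
    (I : set A) :
  right_depth_two phi -> two_sided_ideal I ->
  mul_sets (I `&` centralizer phi) setT `<=`
  mul_sets setT (I `&` centralizer phi).
Proof.
move=> [n [_ /summand_factor[f [g [_ hom_g fgK]]]]] idI.
have sub := subgroup_gen_subgroup.
apply: mul_sets_sub => [|r x [Ir Cr] _]; first exact: sub.
have hom_s := sandwich_hom idfun phi Cr.
rewrite -[r]mul1r -(sandwichE idfun phi Cr) [tens _ _ in X in _ X]fgK.
rewrite (bimodule_hom_sum _ hom_s); apply: subgroup_sum => [|i]; first exact: sub.
(* Left linearity pulls [f_i (1 (x) x)], read as [f_i (1 (x) x) * 1], out. *)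
move: (f i _) => y; have [_ hl _] := bimodule_hom_comp hom_s (hom_g i).
have := hl y (1 : A); rewrite /= mulr1 => ->.
apply: mul_sets_mul => //; apply: sandwich_hom1 => // b.
by exists (phi b), b.
Qed.

Theorem proposition2p1 (k : comPzRingType) (A B : kalgebra k)
  (phi : {rmorphism B -> A}) (hphi : is_kalg_morphism phi) :
  (left_depth_two phi ->
    forall I : set A, two_sided_ideal I ->
      (mul_sets setT (I `&` centralizer phi) `<=`
       mul_sets (I `&` centralizer phi) setT)%classic) /\
  (right_depth_two phi ->
    forall I : set A, two_sided_ideal I ->
      (mul_sets (I `&` centralizer phi) setT `<=`
       mul_sets setT (I `&` centralizer phi))%classic).
Proof.
split=> D2 I idI; first exact: left_depth_two_commutation.
exact: right_depth_two_commutation.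
Qed.
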